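(* Let $\mu=l_1+l_2+l_3$ be a symmetric Lie $2$-algebra structure on a graded vector space $E=E_{-2}\oplus E_{-1}$ and $\alpha$ a symmetric vector valued $2$-form of degree zero on $E$. Let $S:E\to E$ be the Euler map, $S(X)=-|X|X$ for homogeneous $X$. Then $S+\alpha$ is a Nijenhuis vector valued form with respect to $\mu$, with square $S+2\alpha$, if and only if $$\alpha(l_1(\alpha(X,Y)),Z)+\alpha(l_1(\alpha(Y,Z)),X)+\alpha(l_1(\alpha(Z,X)),Y)=0$$ for all $X,Y,Z\in E_{-1}$.
   Context: Base field $\mathbb K=\mathbb R$ or $\mathbb C$; $|X|$ is the degree of a homogeneous $X\in E$. A symmetric vector valued $k$-form ($k\ge 0$) is a graded symmetric $k$-linear map $K:E\times\cdots\times E\to E$ (for $k=0$, an element of $E$). It has degree $\bar K$ if $|K(X_1,\dots,X_k)|=|X_1|+\cdots+|X_k|+\bar K$. Vector valued forms are formal sums of these. (A $2$-form $\alpha$ of degree zero on $E_{-2}\oplus E_{-1}$ is thus a skew-symmetric bilinear map $E_{-1}\times E_{-1}\to E_{-2}$, extended by zero.) Insertion: for a $k$-form $K$ and an $l$-form $L$ with $l\ge1$, $$\iota_KL(X_1,\dots,X_{k+l-1})=\sum_{\sigma\in Sh(k,l-1)}\epsilon(\sigma)L(K(X_{\sigma(1)},\dots,X_{\sigma(k)}),X_{\sigma(k+1)},\dots,X_{\sigma(k+l-1)}),$$ where $Sh(k,l-1)$ is the set of $(k,l-1)$-unshuffles and $\epsilon(\sigma)$ is the Koszul sign; $\iota_KL=0$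 if $L\in E$; $\iota_XK=K(X,\cdot,\dots,\cdot)$ for $X\in E$. Richardson-Nijenhuis bracket: $[K,L]_{_{RN}}=\iota_KL-(-1)^{\bar K\bar L}\iota_LK$, extended to formal sums. A symmetric Lie $2$-algebra structure on $E=E_{-2}\oplus E_{-1}$ is a sum $\mu=l_1+l_2+l_3$ of symmetric vector valued $1$-, $2$-, $3$-forms of degree $1$ with $[\mu,\mu]_{_{RN}}=0$. For a form $\mu$ of degree $1$, a form $\mathcal N$ of degree zero is Nijenhuis with respect to $\mu$ with square $\mathcal K$ if $\mathcal K$ is a vector valued form of degree zero with $[\mathcal N,[\mathcal N,\mu]_{_{RN}}]_{_{RN}}=[\mathcal K,\mu]_{_{RN}}$ and $[\mathcal N,\mathcal K]_{_{RN}}=0$. *)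

(* Defs.v *)
From HB Require Import structures.
From mathcomp Require Import all_boot all_order all_fingroup all_algebra.
From mathcomp Require Import complex.
From mathcomp Require Import reals.

Set Implicit Arguments.
Unset Strict Implicit.
Unset Printing Implicit Defensive.

Import Order.TTheory GRing.Theory Num.Theory.
Local Open Scope ring_scope.

Variant base := RealBase | ComplexBase.

Definition base_field (R : realType) (b : base) : numFieldType :=
  match b with
  | RealBase => R : numFieldType
  | ComplexBase => R[i] : numFieldType
  end.

Section GradedForms.
Variables (K : fieldType) (E2 E1 : lmodType K).

(* E2 is the component of degree -2, E1 the component of degree -1. *)
Definition gspace : lmodType K := (E2 * E1)%type.
Local Notation E := gspace.

Definition gcomp (d : int) (x : E) : E :=
  (if d == -2 then x.1 else 0, if d == -1 then x.2 else 0).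

(* 0 is homogeneous of every degree. *)
Definition homog (d : int) (x : E) : Prop := gcomp d x = x.

(* A formal sum K_0 + K_1 + K_2 + ... of k-linear maps K_k : E^k -> E is
   encoded as one function on finite sequences; K_k is its restriction to the
   sequences of size k. *)
Definition preform := seq E -> E.

Definition multilinear (F : preform) : Prop :=
  forall s t : seq E, linear (fun x => F (s ++ x :: t)).

Definition permute n (s : 'S_n) (X : n.-tuple E) : n.-tuple E :=
  [tuple tnth X (s i) | i < n].

(* The sign e with X_s(1) . ... . X_s(n) = e (X_1 . ... . X_n) in the graded
   symmetric algebra, where |X_i| = d i. *)
Definition koszul n (d : 'I_n -> int) (s : 'S_n) : K :=
  \prod_(i < n) \prod_(j < n | (i < j)%N && (s j < s i)%N)
    (-1) ^ (d (s i) * d (s j)).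

Definition graded_symmetric (F : preform) : Prop :=
  forall n (d : 'I_n -> int) (X : n.-tuple E) (s : 'S_n),
    (forall i, homog (d i) (tnth X i)) ->
    F (permute s X) = koszul d s *: F X.

Definition has_degree (D : int) (F : preform) : Prop :=
  forall n (d : 'I_n -> int) (X : n.-tuple E),
    (forall i, homog (d i) (tnth X i)) ->
    homog (\sum_(i < n) d i + D) (F X).

Definition is_vform (D : int) (F : preform) : Prop :=
  [/\ multilinear F, graded_symmetric F & has_degree D F].

Definition is_kform (k : nat) (D : int) (F : preform) : Prop :=
  is_vform D F /\ (forall X, size X != k -> F X = 0).

Definition unshuffle n (k : nat) (s : 'S_n) : bool :=
  [forall i : 'I_n, forall j : 'I_n,
    (i < j)%N && ((j < k)%N || (k <= i)%N) ==> (s i < s j)%N].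

(* The insertion at homogeneous arguments with |X_i| = d i. For formal sums,
   the component of arity n collects the pairs (k, l) with k + l - 1 = n; the
   arity-0 component of G is never used. *)
Definition insertion_homog n (d : 'I_n -> int) (F G : preform) (X : n.-tuple E) : E :=
  \sum_(k < n.+1) \sum_(s : 'S_n | unshuffle k s)
    koszul d s *: G (F (take k (permute s X)) :: drop k (permute s X)).

Definition deg (b : bool) : int := if b then -2 else -1.

(* Multilinear extension to arbitrary arguments: each of them is split into
   its components of degrees -2 and -1. *)
Definition insertion (F G : preform) : preform := fun X =>
  \sum_(e : {ffun 'I_(size X) -> bool})
    insertion_homog (fun i => deg (e i)) F G
      [tuple gcomp (deg (e i)) (tnth (in_tuple X) i) | i < size X].

(* DF and DG are the degrees of F and G; they are parameters because the zero
   form has every degree. *)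
Definition rn_bracket (DF DG : int) (F G : preform) : preform := fun X =>
  insertion F G X - (-1) ^ (DF * DG) *: insertion G F X.

Definition lie2_structure (l1 l2 l3 : preform) : Prop :=
  [/\ is_kform 1 1 l1, is_kform 2 1 l2, is_kform 3 1 l3 &
      rn_bracket 1 1 (l1 \+ l2 \+ l3) (l1 \+ l2 \+ l3) =1 fun=> 0].

(* N is Nijenhuis with respect to mu, with square Q; mu has degree 1. *)
Definition nijenhuis (mu N Q : preform) : Prop :=
  [/\ is_vform 0 N, is_vform 0 Q,
      rn_bracket 0 1 N (rn_bracket 0 1 N mu) =1 rn_bracket 0 1 Q mu &
      rn_bracket 0 0 N Q =1 fun=> 0].

Definition euler_map (x : E) : E :=
  \sum_(b : bool) (- deg b)%:~R *: gcomp (deg b) x.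

Definition euler : preform := fun X => if X is [:: x] then euler_map x else 0.

End GradedForms.

(* Main.v *)
Require Import Defs.
From HB Require Import structures.
From mathcomp Require Import all_boot all_order all_fingroup all_algebra.
From mathcomp Require Import complex.
From mathcomp Require Import reals.

Set Implicit Arguments.
Unset Strict Implicit.
Unset Printing Implicit Defensive.

Import Order.TTheory GRing.Theory Num.Theory.
Local Open Scope ring_scope.

(** In degrees -2, -1 a degree 1 form mu is a quadruple (d, f, g, h) of maps
    E_{-2} -> E_{-1}, E_{-2} x E_{-1} -> E_{-2}, E_{-1}^2 -> E_{-1} and
    E_{-1}^3 -> E_{-2}, and alpha is a skew bilinear map A : E_{-1}^2 -> E_{-2}.
    The bracket with S + alpha acts on quadruples by
      d |-> d,  f |-> f - A (d _) _,  g |-> g + d A,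
      h |-> h + cyc f (A _ _) _ - cyc A (g _ _) _.
    Applying it twice gives the same d, f, g as applying it once with 2 A in
    place of A, while the h-components differ by 2 cyc A (d (A _ _)) _; this
    vanishes exactly when the cyclic sum does. *)

(** * Sums over permutations and functions on small ordinals *)

Lemma sum_perm_recl (V : nmodType) n (F : 'S_n.+1 -> V) :
  \sum_s F s = \sum_(i < n.+1) \sum_(t : 'S_n) F (lift_perm ord0 i t).
Proof.
rewrite pair_bigA /=.
rewrite (reindex (fun p : 'I_n.+1 * 'S_n => lift_perm ord0 p.1 p.2)) //=.
(* Injectivity is enough, since (n+1)! = (n+1) n!. *)
apply: onW_bij; apply: inj_card_bij => [[i s] [j t] /= e|]; last first.
  by rewrite card_prod card_ord !card_Sn factS.
have eij : i = j by rewrite -(lift_perm_id ord0 i s) e lift_perm_id.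
rewrite -eij in e *; congr pair; apply/permP => k.
by apply: (@lift_inj _ i); rewrite -!(lift_perm_lift ord0) e.
Qed.

Lemma sum_perm0 (V : nmodType) (F : 'S_0 -> V) : \sum_s F s = F 1%g.
Proof.
by rewrite (big_pred1 1%g) // => s; apply/esym/eqP/permP => -[].
Qed.

(** Used to split off, one argument at a time, the choice of homogeneous component in
    [insertion]. *)
Lemma sum_ffun_recl (V : nmodType) (T : finType) n
    (F : {ffun 'I_n.+1 -> T} -> V) :
  \sum_e F e = \sum_b \sum_(e : {ffun 'I_n -> T})
    F [ffun i => if unlift ord0 i is Some j then e j else b].
Proof.
rewrite pair_bigA /=.
rewrite (reindex (fun p : T * {ffun 'I_n -> T} =>
  [ffun i => if unlift ord0 i is Some j then p.2 j else p.1])) //=.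
exists (fun e : {ffun 'I_n.+1 -> T} => (e ord0, [ffun j => e (lift ord0 j)]))
  => [[b e] _|e _] /=.
  rewrite ffunE unlift_none; congr pair; apply/ffunP => j.
  by rewrite !ffunE liftK.
by apply/ffunP => i; rewrite ffunE; case: unliftP => [j|] ->; rewrite ?ffunE.
Qed.

Lemma sum_ffun0 (V : nmodType) (T : finType) (F : {ffun 'I_0 -> T} -> V) e :
  \sum_e F e = F e.
Proof.
by rewrite (big_pred1 e) // => e'; apply/esym/eqP/ffunP => -[].
Qed.

Lemma forall_ord_recl n (P : pred 'I_n.+1) :
  [forall i, P i] = P ord0 && [forall i, P (lift ord0 i)].
Proof.
apply/forallP/andP => [hP|[P0 /forallP hP] i].
  by split=> //; apply/forallP.
by case: (unliftP ord0 i) => [j|] ->.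
Qed.

Lemma forall_ord0 (P : pred 'I_0) : [forall i, P i].
Proof. by apply/forallP => -[]. Qed.

Lemma lift_lift0 n (i : 'I_n.+1) : lift (lift ord0 i) ord0 = ord0.
Proof. exact: ord_inj. Qed.

Lemma lift_lift_lift n (i : 'I_n.+1) (j : 'I_n) :
  lift (lift ord0 i) (lift ord0 j) = lift ord0 (lift i j).
Proof. by apply: ord_inj; rewrite /= !bumpS. Qed.

Local Notation i0 := ord0.
Local Notation i1 := (lift ord0 ord0).
Local Notation i2 := (lift ord0 (lift ord0 ord0)).

Definition lift_permE :=
  (lift_perm_id, lift_perm_lift, @lift_lift0, @lift_lift_lift).

(** The permutation of three points with Lehmer code (i, j): 0 goes to i, and 1 to the j-th
    remaining index in increasing order. *)
Definition perm3 (i : 'I_3) (j : 'I_2) : 'S_3 :=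
  lift_perm ord0 i (lift_perm ord0 j 1%g).

Lemma sum_perm3 (V : nmodType) (F : 'S_3 -> V) :
  \sum_s F s = F (perm3 i0 i0) + F (perm3 i0 i1) +
    (F (perm3 i1 i0) + F (perm3 i1 i1)) + (F (perm3 i2 i0) + F (perm3 i2 i1)).
Proof.
rewrite !(sum_perm_recl, big_ord_recl, big_ord0) /= !sum_perm0.
have e1 : lift_perm ord0 ord0 1%g = 1%g :> 'S_1.
  by apply/permP => i; rewrite !ord1.
by rewrite e1 !addr0 !addrA.
Qed.

Lemma perm3E i j : (perm3 i j i0 = i) * (perm3 i j i1 = lift i j) *
  (perm3 i j i2 = lift i (lift j ord0)).
Proof. by rewrite /perm3 !lift_permE !perm1. Qed.

(** A pair of positions i < j is constrained exactly when both lie in the same block, that is when j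
    < k or k <= i. *)
Lemma unshuffle3 k (s : 'S_3) :
  unshuffle k s = [&& ((1 < k) || (k <= 0)) ==> (s i0 < s i1),
    ((2 < k) || (k <= 0)) ==> (s i0 < s i2) &
    ((2 < k) || (k <= 1)) ==> (s i1 < s i2)]%N.
Proof.
rewrite /unshuffle !(forall_ord_recl, forall_ord0) /=.
by rewrite !(andbT, implybT) !andbA.
Qed.

(** * Explicit insertion formulas for at most three arguments *)

Section Insertion.
Variables (K : fieldType) (E2 E1 : lmodType K).
Local Notation E := (gspace E2 E1).
Implicit Types F G : preform E2 E1.

(** As in [deg], [true] stands for degree -2 and [false] for degree -1. *)
Definition hpart (b : bool) (x : E) : E := gcomp (deg b) x.

(** The factor that the positions i < j contribute to the Koszul sign, nontrivial only at an
    inversion. *)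
Definition ksign (d : 'I_3 -> int) (s : 'S_3) i j : K :=
  if (s j < s i)%N then (-1) ^ (d (s i) * d (s j)) else 1.

Lemma koszul3 (d : 'I_3 -> int) (s : 'S_3) :
  koszul K d s = ksign d s i0 i1 * ksign d s i0 i2 * ksign d s i1 i2.
Proof.
rewrite /koszul !(big_ord_recl, big_ord0) !(big_mkcond (fun _ => _ && _)) /=.
by rewrite !(big_ord_recl, big_ord0) /= ?(mul1r, mulr1).
Qed.

Lemma permute3 (s : 'S_3) (X : 3.-tuple E) :
  permute s X = [tuple tnth X (s i0); tnth X (s i1); tnth X (s i2)].
Proof.
by apply: val_inj; rewrite /= !(enum_ordSl, enum_ord0).
Qed.

(** The groups correspond to the arities 0, 1, 2, 3 of the inserted component. Each unshuffle gives
    one summand, with the sign of moving the selected arguments to the front. *)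
Lemma insertion_homog3 (d : 'I_3 -> int) F G (X : 3.-tuple E) :
  let x := tnth X in
  insertion_homog d F G X =
  G [:: F [::]; x i0; x i1; x i2] +
  (G [:: F [:: x i0]; x i1; x i2] +
   (-1) ^ (d i1 * d i0) *: G [:: F [:: x i1]; x i0; x i2] +
   ((-1) ^ (d i2 * d i0) * (-1) ^ (d i2 * d i1)) *:
     G [:: F [:: x i2]; x i0; x i1]) +
  (G [:: F [:: x i0; x i1]; x i2] +
   (-1) ^ (d i2 * d i1) *: G [:: F [:: x i0; x i2]; x i1] +
   ((-1) ^ (d i1 * d i0) * (-1) ^ (d i2 * d i0)) *:
     G [:: F [:: x i1; x i2]; x i0]) +
  G [:: F [:: x i0; x i1; x i2]].
Proof.
move=> x; rewrite /insertion_homog !(big_ord_recl, big_ord0).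
rewrite !(big_mkcond (unshuffle _)) !sum_perm3 !unshuffle3 !perm3E.
rewrite !permute3 !perm3E /=.
rewrite !koszul3 /ksign !perm3E !(lift_lift0, lift_lift_lift) /=.
by rewrite ?(mul1r, mulr1, add0r, addr0, scale1r, addrA).
Qed.

(** The Koszul sign of an exchange: elements of degree -2 are even, so only two elements of degree
    -1 anticommute. *)
Definition eps (a b : bool) : K := if a || b then 1 else -1.

Lemma signE a b : (-1) ^ (deg a * deg b) = eps a b.
Proof.
have -> : deg a * deg b = Posz ((a.+1 * b.+1)%N) by case: a b => -[].
rewrite -exprnP -signr_odd oddM /eps /=.
by case: a b => -[]; rewrite ?expr0 ?expr1.
Qed.

Lemma insertion_nil F G : insertion F G [::] = G [:: F [::]].
Proof.
rewrite /insertion (sum_ffun0 _ [ffun=> false]) /insertion_homog.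
rewrite big_ord_recl big_ord0 /= big_mkcond /= sum_perm0.
rewrite /unshuffle forall_ord0 /koszul big_ord0 /= enum_ord0 /=.
by rewrite scale1r addr0.
Qed.

Lemma insertion1 F G (x : E) :
  insertion F G [:: x] =
  \sum_a (G [:: F [::]; hpart a x] + G [:: F [:: hpart a x]]).
Proof.
rewrite /insertion sum_ffun_recl; apply: eq_bigr => a _.
rewrite (sum_ffun0 _ [ffun=> false]) /insertion_homog.
rewrite !(big_ord_recl, big_ord0) /=.
rewrite !(big_mkcond (unshuffle _)) !sum_perm_recl.
rewrite !(big_ord_recl, big_ord0) /= !sum_perm0.
rewrite /unshuffle !(forall_ord_recl, forall_ord0) /=.
rewrite /koszul !(big_ord_recl, big_ord0) /=.
rewrite !(big_mkcond (fun _ => _ && _)) !(big_ord_recl, big_ord0) /=.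
rewrite !(enum_ordSl, enum_ord0) /=.
rewrite !(lift_perm_id, tnth_mktuple, ffunE, unlift_none, liftK) /=.
by rewrite ?(mul1r, mulr1, add0r, addr0, scale1r, addrA).
Qed.

Lemma insertion2 F G (x y : E) :
  insertion F G [:: x; y] = \sum_a \sum_b
  (G [:: F [::]; hpart a x; hpart b y] +
   (G [:: F [:: hpart a x]; hpart b y] +
    eps b a *: G [:: F [:: hpart b y]; hpart a x]) +
   G [:: F [:: hpart a x; hpart b y]]).
Proof.
rewrite /insertion sum_ffun_recl; apply: eq_bigr => a _.
rewrite sum_ffun_recl; apply: eq_bigr => b _.
rewrite (sum_ffun0 _ [ffun=> false]) /insertion_homog.
rewrite !(big_ord_recl, big_ord0) /=.
rewrite !(big_mkcond (unshuffle _)).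
rewrite !(sum_perm_recl, big_ord_recl, big_ord0) /= !sum_perm0.
rewrite /unshuffle !(forall_ord_recl, forall_ord0) /=.
rewrite !(lift_perm_id, lift_perm_lift) /=.
rewrite /koszul !(big_ord_recl, big_ord0) /=.
rewrite !(big_mkcond (fun _ => _ && _)) !(big_ord_recl, big_ord0) /=.
rewrite !(enum_ordSl, enum_ord0) /=.
rewrite !(lift_perm_id, lift_perm_lift) /=.
rewrite !(lift_lift0, lift_lift_lift) !(tnth_mktuple, ffunE).
rewrite !(unlift_none, liftK) /=.
rewrite ?(ffunE, unlift_none, liftK) /= ?signE.
by rewrite ?(mul1r, mulr1, add0r, addr0, scale1r, addrA).
Qed.

Lemma insertion3 F G (x y z : E) :
  insertion F G [:: x; y; z] = \sum_a \sum_b \sum_c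
  (G [:: F [::]; hpart a x; hpart b y; hpart c z] +
   (G [:: F [:: hpart a x]; hpart b y; hpart c z] +
    eps b a *: G [:: F [:: hpart b y]; hpart a x; hpart c z] +
    (eps c a * eps c b) *: G [:: F [:: hpart c z]; hpart a x; hpart b y]) +
   (G [:: F [:: hpart a x; hpart b y]; hpart c z] +
    eps c b *: G [:: F [:: hpart a x; hpart c z]; hpart b y] +
    (eps b a * eps c a) *: G [:: F [:: hpart b y; hpart c z]; hpart a x]) +
   G [:: F [:: hpart a x; hpart b y; hpart c z]]).
Proof.
rewrite /insertion sum_ffun_recl; apply: eq_bigr => a _.
rewrite sum_ffun_recl; apply: eq_bigr => b _.
rewrite sum_ffun_recl; apply: eq_bigr => c _.
rewrite (sum_ffun0 _ [ffun=> false]) insertion_homog3.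
rewrite !(tnth_mktuple, ffunE, unlift_none, liftK) /=.
by rewrite ?(ffunE, unlift_none, liftK) !signE.
Qed.

(** Serves for four or more arguments: asking that all composites of the right size vanish avoids
    enumerating permutations. *)
Lemma insertion_eq0 F G (X : seq E) :
  (forall (k : nat) (Y : seq E), size Y = size X ->
    G (F (take k Y) :: drop k Y) = 0) ->
  insertion F G X = 0.
Proof.
move=> h; rewrite /insertion big1 // => e _.
rewrite /insertion_homog big1 // => k _.
by rewrite big1 // => s _; rewrite h ?scaler0 ?size_tuple.
Qed.

(** Forms are compared pointwise; this and the next lemma replace them inside a bracket without
    function extensionality. *)
Lemma eq_insertion F F' G G' : F =1 F' -> G =1 G' ->
  insertion F G =1 insertion F' G'.
Proof.
move=> eF eG X; apply: eq_bigr => e _; apply: eq_bigr => k _.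
apply: eq_bigr => s _.
by rewrite eF eG.
Qed.

Lemma eq_rn_bracket DF DG F F' G G' : F =1 F' -> G =1 G' ->
  rn_bracket DF DG F G =1 rn_bracket DF DG F' G'.
Proof.
move=> eF eG X.
by rewrite /rn_bracket (eq_insertion eF eG) (eq_insertion eG eF).
Qed.

End Insertion.

(** * Forms in coordinates and their brackets with S + alpha *)

Section CoordinateForms.
Variables (K : fieldType) (E2 E1 : lmodType K).
Local Notation E := (gspace E2 E1).

Lemma hpartE (x : E) : (hpart true x = (x.1, 0)) * (hpart false x = (0, x.2)).
Proof. by []. Qed.

Lemma euler_mapE (x : E) : euler_map x = (x.1 *+ 2, x.2).
Proof.
rewrite /euler_map big_bool /= /gcomp /= !opprK.
apply: injective_projections;
  by rewrite /= ?scaler0 ?addr0 ?add0r ?scale1r // scaler_nat.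
Qed.

Lemma linear_homo (U V : lmodType K) (f : U -> V) : linear f ->
  [/\ f 0 = 0, {morph f : u v / u + v}, {morph f : u / - u} &
      forall n, {morph f : u / u *+ n}].
Proof.
move=> lf.
have fD u v : f (u + v) = f u + f v by rewrite -[u]scale1r lf !scale1r.
have f0 : f 0 = 0 by apply: (addrI (f 0)); rewrite -fD !addr0.
split=> // [u|n u]; first by apply: (addrI (f u)); rewrite -fD !subrr f0.
by elim: n => [|n IH]; rewrite ?mulr0n // !mulrS fD IH.
Qed.

Definition skew2 (U V : lmodType K) (f : U -> U -> V) :=
  (forall y, linear (f^~ y)) /\ (forall x y, f y x = - f x y).

(** The two adjacent transpositions generate the symmetric group, so these conditions give full
    skew-symmetry and, with it, linearity in every argument. *)
Definition skew3 (U V : lmodType K) (f : U -> U -> U -> V) :=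
  [/\ forall y z, linear (fun x => f x y z), forall x y z, f y x z = - f x y z &
      forall x y z, f x z y = - f x y z].

Lemma skew2_linearr (U V : lmodType K) (f : U -> U -> V) :
  skew2 f -> forall x, linear (f x).
Proof.
case=> fl fC x c u v.
by rewrite (fC _ x) fl (fC x u) (fC x v) scalerN opprD !opprK.
Qed.

Lemma linear_comp (U V W : lmodType K) (f : U -> V) (g : V -> W) :
  linear f -> linear g -> linear (fun x => g (f x)).
Proof. by move=> lf lg c u v; rewrite lf lg. Qed.

Lemma linear_add (U V : lmodType K) (f g : U -> V) :
  linear f -> linear g -> linear (fun x => f x + g x).
Proof. by move=> lf lg c u v; rewrite lf lg scalerDr addrACA. Qed.

Lemma linear_sub (U V : lmodType K) (f g : U -> V) :
  linear f -> linear g -> linear (fun x => f x - g x).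
Proof. by move=> lf lg c u v; rewrite lf lg scalerBr opprD addrACA. Qed.

Definition euler_plus (A : E1 -> E1 -> E2) : preform E2 E1 := fun X =>
  match X with
  | [:: x] => euler_map x
  | [:: x; y] => (A x.2 y.2, 0)
  | _ => 0
  end.

(** The two terms in [f] are the two orders of a mixed pair; they have equal signs because degree -2
    is even. *)
Definition quad_form (d : E2 -> E1) (f : E2 -> E1 -> E2) (g : E1 -> E1 -> E1)
    (h : E1 -> E1 -> E1 -> E2) : preform E2 E1 := fun X =>
  match X with
  | [:: x] => (0, d x.1)
  | [:: x; y] => (f x.1 y.2 + f y.1 x.2, g x.2 y.2)
  | [:: x; y; z] => (h x.2 y.2 z.2, 0)
  | _ => 0
  end.

Record quadruple d f g h : Prop := Quadruple {
  d_linear : linear (d : E2 -> E1);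
  f_linearl : forall y, linear ((f : E2 -> E1 -> E2)^~ y);
  f_linearr : forall a, linear (f a);
  g_skew : skew2 (g : E1 -> E1 -> E1);
  h_skew : skew3 (h : E1 -> E1 -> E1 -> E2) }.

Section Bracket.
Variables (A : E1 -> E1 -> E2) (d : E2 -> E1) (f : E2 -> E1 -> E2)
  (g : E1 -> E1 -> E1) (h : E1 -> E1 -> E1 -> E2).
Hypotheses (skA : skew2 A) (D : quadruple d f g h).

Definition bracket_f a y := f a y - A (d a) y.
Definition bracket_g x y := g x y + d (A x y).
Definition bracket_h x y z := h x y z +
  (f (A x y) z + f (A y z) x + f (A z x) y) -
  (A (g x y) z + A (g y z) x + A (g z x) y).

(** Each [hpart] has a zero component, so these vanishing facts remove most summands of the
    expansions below. *)
Let d0 : d 0 = 0. Proof. by case: (linear_homo (d_linear D)). Qed.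
Let f0l y : f 0 y = 0. Proof. by case: (linear_homo (f_linearl D y)). Qed.
Let f0r a : f a 0 = 0. Proof. by case: (linear_homo (f_linearr D a)). Qed.
Let A0l x : A 0 x = 0. Proof. by case: skA => /(_ x)/linear_homo[]. Qed.
Let A0r x : A x 0 = 0. Proof. by case: (skA) => _ ->; rewrite A0l oppr0. Qed.
Let g0l x : g 0 x = 0. Proof. by case: (g_skew D) => /(_ x)/linear_homo[]. Qed.
Let g0r x : g x 0 = 0.
Proof. by case: (g_skew D) => _ ->; rewrite g0l oppr0. Qed.
Let h0l x y : h 0 x y = 0.
Proof. by case: (h_skew D) => /(_ x y)/linear_homo[]. Qed.
Let h0m x y : h x 0 y = 0.
Proof. by case: (h_skew D) => _ -> _; rewrite h0l oppr0. Qed.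
Let h0r x y : h x y 0 = 0.
Proof. by case: (h_skew D) => _ _ ->; rewrite h0m oppr0. Qed.
Let zeros := (d0, f0l, f0r, A0l, A0r, g0l, g0r, h0l, h0m, h0r).
Let simp := (add0r, addr0, mul0rn, subr0, oppr0, scaler0, scale1r, scaleN1r).

Let d2 a : d (a *+ 2) = d a *+ 2.
Proof. by case: (linear_homo (d_linear D)) => _ _ _ ->. Qed.
Let f2 a y : f (a *+ 2) y = f a y *+ 2.
Proof. by case: (linear_homo (f_linearl D y)) => _ _ _ ->. Qed.
Let fN a y : f (- a) y = - f a y.
Proof. by case: (linear_homo (f_linearl D y)) => _ _ ->. Qed.
Let AN x y : A (- x) y = - A x y.
Proof. by case: (linear_homo (skA.1 y)) => _ _ ->. Qed.
(** This and [cancel3] express that the bracket with S fixes forms of degree 1. S has weights 2 and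
    1 on E_{-2} and E_{-1}: its insertion into the slots of f or h gives 3 u, its application to the
    value in E_{-2} gives 2 u, and one u remains. *)
Let cancel (u a : E2) : u *+ 2 + u - (a + u *+ 2) = u - a.
Proof. by rewrite (addrC _ u) (addrC a) addrKA. Qed.
Let cancel3 (u s t : E2) : u + u + u + s - (t + u *+ 2) = u + s - t.
Proof. by rewrite -mulr2n -(addrA (u *+ 2)) (addrC (u *+ 2)) (addrC t) addrKA. Qed.

Lemma bracket_quad_form :
  rn_bracket 0 1 (euler_plus A) (quad_form d f g h) =1
  quad_form d bracket_f bracket_g bracket_h.
Proof.
rewrite /rn_bracket => X; rewrite mul0r expr0z scale1r.
case: X => [|x [|y [|z [|t X]]]].
- by rewrite !insertion_nil /= euler_mapE /= d0 mul0rn subrr.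
- rewrite !insertion1 !big_bool !hpartE /= !euler_mapE /= ?zeros !simp ?zeros.
  apply: injective_projections; rewrite /= !simp ?subrr // d2.
  by rewrite mulr2n addrK.
- rewrite !insertion2 !big_bool !hpartE /= !euler_mapE /= /eps /= ?zeros !simp ?zeros.
  apply: injective_projections; rewrite /= !simp ?f2 /bracket_f.
    by rewrite opprD addrACA (addrC (f y.1 x.2)) !cancel.
  (* The summand with exchanged arguments carries the sign -1, so skew-symmetry makes it a second
     g(x, y); one of the two cancels against S applied to the value. *)
  by rewrite ((g_skew D).2 x.2) opprK addrAC addrK.
- rewrite !insertion3 !big_bool !hpartE /= !euler_mapE /= /eps /= ?zeros !simp ?zeros.
  apply: injective_projections; rewrite /= ?mulrNN ?mulr1 !simp // /bracket_h.
  case: (h_skew D) => _ h12 h23.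
  rewrite (h12 x.2 y.2) (h12 x.2 z.2) (h23 x.2 y.2) !opprK.
  (* The unshuffle selecting x and z has sign -1; reversing the pair absorbs it and produces the
     cyclic order (z, x). *)
  rewrite (skA.2 z.2 x.2) fN opprK ((g_skew D).2 z.2 x.2) AN opprK.
  rewrite (addrAC (f _ _)) (addrAC (A _ _)).
  exact: cancel3.
(* By arity the only composites left to examine are of type h(A(x, y), z, t) and A(h(x, y, z), t),
   up to terms with a zero inserted. They vanish because the inner value lies in E_{-2} while the
   outer map reads components in E_{-1}. *)
- rewrite !insertion_eq0 ?subr0 //.
    case=> [|[|[|[|k]]]] [|y1 [|y2 [|y3 [|y4 Y]]]] //= _;
      rewrite ?zeros //; first by case: Y.
    by case: (drop _ _) => [|? [|? ?]]; rewrite ?euler_mapE /= ?zeros ?mul0rn.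
  case=> [|[|[|[|k]]]] [|y1 [|y2 [|y3 [|y4 Y]]]] //= _;
    rewrite ?zeros //.
  - by case: Y => [|? [|? ?]]; rewrite ?addr0 ?zeros.
  - by case: Y => [|? [|? ?]]; rewrite ?addr0 ?zeros.
  by case: (drop _ _) => [|? [|? [|? ?]]]; rewrite /= ?zeros ?addr0.
Qed.

Let flr := f_linearr D.
Let fll := f_linearl D.
Let gll := (g_skew D).1.
Let glr := skew2_linearr (g_skew D).
Let All := skA.1.
Let Alr := skew2_linearr skA.

(** Closure under the bracket, so that [bracket_quad_form] can be applied a second time. *)
Lemma bracket_quad : quadruple d bracket_f bracket_g bracket_h.
Proof.
case: (h_skew D) => hl h12 h23.
split=> [|y|a||]; first exact: d_linear D.
- exact: linear_sub (fll y) (linear_comp (d_linear D) (All y)).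
- exact: linear_sub (flr a) (Alr (d a)).
- split=> [y|x y]; first exact: linear_add (gll y) (linear_comp (All y) (d_linear D)).
  rewrite /bracket_g (g_skew D).2 skA.2 opprD; congr (_ + _).
  by case: (linear_homo (d_linear D)).
split=> [y z|x y z|x y z].
- apply: linear_sub; [apply: linear_add => //|];
    (apply: linear_add; [apply: linear_add|]).
  + exact: linear_comp (All y) (fll z).
  + exact: flr.
  + exact: linear_comp (Alr z) (fll y).
  + exact: linear_comp (gll y) (All z).
  + exact: Alr.
  + exact: linear_comp (glr z) (All y).
- rewrite /bracket_h h12 (skA.2 x y) (skA.2 z x) (skA.2 y z) !fN.
  rewrite ((g_skew D).2 x y) ((g_skew D).2 z x) ((g_skew D).2 y z) !AN.
  rewrite -!opprD; congr (- (_ + _ - _)); exact: addrAC.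
- rewrite /bracket_h h23 (skA.2 x y) (skA.2 z x) (skA.2 y z) !fN.
  rewrite ((g_skew D).2 x y) ((g_skew D).2 z x) ((g_skew D).2 y z) !AN.
  rewrite -!opprD; congr (- (_ + _ - _)); by rewrite addrC addrA addrAC.
Qed.

End Bracket.

(** The bracket with S kills forms of degree 0, and A and B compose to zero because their values lie
    in E_{-2} and their arguments are read in E_{-1}. *)
Lemma bracket_euler_plus A B : skew2 A -> skew2 B ->
  rn_bracket 0 0 (euler_plus A) (euler_plus B) =1 fun=> 0.
Proof.
move=> skA skB.
have A0l x : A 0 x = 0 by case: (linear_homo (skA.1 x)).
have A0r x : A x 0 = 0 by rewrite skA.2 A0l oppr0.
have B0l x : B 0 x = 0 by case: (linear_homo (skB.1 x)).
have B0r x : B x 0 = 0 by rewrite skB.2 B0l oppr0.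
pose zeros := (A0l, A0r, B0l, B0r).
rewrite /rn_bracket => X; rewrite mul0r expr0z scale1r.
case: X => [|x [|y [|z [|t X]]]].
- by rewrite !insertion_nil subrr.
- by rewrite !insertion1 !big_bool !hpartE /= !euler_mapE /= ?zeros subrr.
- rewrite !insertion2 !big_bool !hpartE /= !euler_mapE /= /eps /= ?zeros ?mul0rn.
  rewrite !(add0r, addr0, scale1r, scaleN1r).
  apply: injective_projections; rewrite /= ?(subr0, addr0) //.
  by rewrite (skA.2 x.2) (skB.2 x.2) !opprK -!mulr2n (addrC (A _ _ *+ 2)) subrr.
- rewrite !insertion3 !big_bool !hpartE /= !euler_mapE /= /eps /= ?zeros.
  by rewrite !(mul0rn, add0r, addr0, scaler0) oppr0.
- rewrite !insertion_eq0 ?subr0 //.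
    case=> [|[|[|[|k]]]] [|y1 [|y2 [|y3 [|y4 Y]]]] //= _;
      rewrite ?zeros //; first by case: Y.
    by case: (drop _ _) => [|? [|? ?]]; rewrite ?euler_mapE /= ?zeros ?mul0rn.
  case=> [|[|[|[|k]]]] [|y1 [|y2 [|y3 [|y4 Y]]]] //= _;
      rewrite ?zeros //; first by case: Y.
  by case: (drop _ _) => [|? [|? ?]]; rewrite ?euler_mapE /= ?zeros ?mul0rn.
Qed.

(** The factor 2 stays in the condition because the field is arbitrary here. *)
Lemma double_bracketP (A : E1 -> E1 -> E2) (d : E2 -> E1) f g h :
  skew2 A -> quadruple d f g h ->
  let C x y z := A (d (A x y)) z + A (d (A y z)) x + A (d (A z x)) y in
  (rn_bracket 0 1 (euler_plus A)
     (rn_bracket 0 1 (euler_plus A) (quad_form d f g h)) =1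
   rn_bracket 0 1 (euler_plus (fun x y => A x y *+ 2)) (quad_form d f g h)) <->
  forall x y z, C x y z *+ 2 = 0.
Proof.
move=> skA D C.
have sk2A : skew2 (fun x y => A x y *+ 2).
  split=> [y c u v|x y]; first by rewrite skA.1 mulrnDl scalerMnr.
  by rewrite skA.2 mulNrn.
have D' := bracket_quad skA D.
have d2 n : {morph d : u / u *+ n} by case: (linear_homo (d_linear D)).
have AD z : {morph A^~ z : u v / u + v} by case: (linear_homo (skA.1 z)).
have f2 n z : {morph f^~ z : u / u *+ n} by case: (linear_homo (f_linearl D z)).
have ef a y : bracket_f A d (bracket_f A d f) a y =
    bracket_f (fun x y => A x y *+ 2) d f a y.
  by rewrite /bracket_f mulr2n opprD addrA.
have eg x y : bracket_g A d (bracket_g A d g) x y =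
    bracket_g (fun x y => A x y *+ 2) d g x y.
  by rewrite /bracket_g d2 mulr2n addrA.
have h2 x y z : bracket_h A (bracket_f A d f) (bracket_g A d g)
      (bracket_h A f g h) x y z
    = bracket_h (fun x y => A x y *+ 2) f g h x y z - C x y z *+ 2.
  rewrite /bracket_h /bracket_f /bracket_g !AD !f2.
  (* The correction - A (d _) _ in f contributes one copy of - C; the correction d A in g
     contributes C to the subtracted sum, hence a second copy of - C. *)
  rewrite [X in _ + X - _]
    (_ : _ = f (A x y) z + f (A y z) x + f (A z x) y - C x y z); last first.
    by rewrite /C !opprD [RHS]addrACA; congr (_ + _); exact: addrACA.
  rewrite [X in _ - X]
    (_ : _ = A (g x y) z + A (g y z) x + A (g z x) y + C x y z); last first.
    by rewrite /C [RHS]addrACA; congr (_ + _); exact: addrACA.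
  rewrite -!mulrnDl; move: (f _ _ + _ + _) (A _ _ + _ + _) (C x y z) => u v w.
  by rewrite !mulr2n !opprD !addrA [LHS](ACl (1*2*4*3*6*5*7)).
split=> [e x y z|C0 X].
  have := e [:: (0, x); (0, y); (0, z)].
  rewrite (eq_rn_bracket _ _ (frefl _) (bracket_quad_form skA D)).
  rewrite (bracket_quad_form skA D') (bracket_quad_form sk2A D) /= h2 => -[] /eqP.
  by rewrite -subr_eq0 addrAC subrr sub0r oppr_eq0 => /eqP.
rewrite (eq_rn_bracket _ _ (frefl _) (bracket_quad_form skA D)).
rewrite (bracket_quad_form skA D') (bracket_quad_form sk2A D).
(* Only arity three uses the cyclic condition; in lower arities the two sides agree identically. *)
case: X => [|x [|y [|z [|t X]]]] //=; last by rewrite h2 C0 subr0.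
by rewrite !ef eg.
Qed.

End CoordinateForms.

(** * Coordinates of graded symmetric forms, and the equivalence *)

Section Coordinates.
Variables (K : fieldType) (E2 E1 : lmodType K).
Local Notation E := (gspace E2 E1).
Implicit Types (F G : preform E2 E1) (x y z : E).

(** At a concrete degree the conditional computes to the one relevant equation, which later proofs
    obtain by type ascription. *)
Lemma homogP (n : int) x : homog n x ->
  if n == -2 then x.2 = 0 else if n == -1 then x.1 = 0 else x = 0.
Proof.
by rewrite /homog => <-; rewrite /gcomp; case: eqVneq => [->|_] //=; case: eqVneq.
Qed.

Lemma homog_hpart b x : homog (deg b) (hpart b x).
Proof. by case: b. Qed.

Lemma hpart_split x : x = hpart true x + hpart false x.
Proof. by rewrite !hpartE; apply: injective_projections; rewrite /= ?addr0 ?add0r. Qed.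

Lemma multilinear_split F s x t : multilinear F ->
  F (s ++ x :: t) = F (s ++ hpart true x :: t) + F (s ++ hpart false x :: t).
Proof. by move=> /(_ s t)/linear_homo[_ FD _ _]; rewrite -FD -hpart_split. Qed.

Lemma has_degree1 D F a x :
  has_degree D F -> homog (deg a + D) (F [:: hpart a x]).
Proof.
move=> /(_ 1 (fun i => nth 0 [:: deg a] i) [tuple hpart a x]).
rewrite !(big_ord_recl, big_ord0) addr0; apply.
by case=> -[|[|[]]] //= i; exact: homog_hpart.
Qed.

Lemma has_degree2 D F a b x y : has_degree D F ->
  homog (deg a + deg b + D) (F [:: hpart a x; hpart b y]).
Proof.
move=> /(_ 2 (fun i => nth 0 [:: deg a; deg b] i) [tuple hpart a x; hpart b y]).
rewrite !(big_ord_recl, big_ord0) addr0; apply.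
by case=> -[|[|[]]] //= i; exact: homog_hpart.
Qed.

Lemma has_degree3 D F a b c x y z : has_degree D F ->
  homog (deg a + (deg b + deg c) + D) (F [:: hpart a x; hpart b y; hpart c z]).
Proof.
move=> /(_ 3 (fun i => nth 0 [:: deg a; deg b; deg c] i)
  [tuple hpart a x; hpart b y; hpart c z]).
rewrite !(big_ord_recl, big_ord0) addr0; apply.
by case=> -[|[|[|[]]]] //= i; exact: homog_hpart.
Qed.

Lemma graded_symmetric2 F a b x y : graded_symmetric F ->
  F [:: hpart b y; hpart a x] = eps K b a *: F [:: hpart a x; hpart b y].
Proof.
pose s : 'S_2 := lift_perm ord0 i1 1%g; pose X := [tuple hpart a x; hpart b y].
have sE : (s i0 = i1) * (s i1 = i0) by rewrite /s !lift_permE perm1 lift_lift0.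
have -> : [:: hpart b y; hpart a x] = permute s X.
  by rewrite /permute /= !(enum_ordSl, enum_ord0) /= !sE.
move=> /(_ 2 (fun i => nth 0 [:: deg a; deg b] i) X s) ->; last first.
  by case=> -[|[|[]]] //= i; exact: homog_hpart.
rewrite /koszul !(big_ord_recl, big_ord0) !(big_mkcond (fun _ => _ && _)).
by rewrite !(big_ord_recl, big_ord0) !sE /= !(mul1r, mulr1) signE.
Qed.

Lemma graded_symmetric3 F x y z (f := hpart false) : graded_symmetric F ->
  (F [:: f y; f x; f z] = - F [:: f x; f y; f z]) *
  (F [:: f x; f z; f y] = - F [:: f x; f y; f z]).
Proof.
move=> symF; pose X := [tuple f x; f y; f z].
have hX i : homog (-1) (tnth X i) by case: i => -[|[|[|[]]]].
(* [perm3 i1 i0] and [perm3 i0 i1] are the adjacent transpositions; each inverts one pair of odd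
   elements, whence the sign -1. *)
have := symF 3 (fun=> -1) X (perm3 i1 i0) hX.
have := symF 3 (fun=> -1) X (perm3 i0 i1) hX.
rewrite !koszul3 /ksign !permute3 !perm3E !(lift_lift0, lift_lift_lift) /=.
rewrite !(mul1r, mulr1).
by rewrite (signE K false false) /eps /= !scaleN1r => -> ->.
Qed.

Lemma linear_inl : linear (fun a : E2 => (a, 0) : E).
Proof.
by move=> c u v; apply: injective_projections; rewrite //= scaler0 addr0.
Qed.

Lemma linear_inr : linear (fun v : E1 => (0, v) : E).
Proof.
by move=> c u v; apply: injective_projections; rewrite //= scaler0 addr0.
Qed.

Lemma linear_fst : linear (fun x => x.1).
Proof. by []. Qed.

Lemma linear_snd : linear (fun x => x.2).
Proof. by []. Qed.

(** Two arguments have total degree -4, -3 or -2, and only -2 is a degree of E: both arguments must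
    lie in E_{-1}, and the value in E_{-2}. *)
Lemma degree0_form F : is_kform 2 0 F ->
  exists2 A : E1 -> E1 -> E2, skew2 A &
    forall X, F X = if X is [:: x; y] then (A x.2 y.2, 0) else 0.
Proof.
case=> -[mul sym hdeg] supp.
exists (fun u v => (F [:: (0, u); (0, v)]).1) => [|X].
  split=> [v|u v].
    exact: linear_comp (linear_comp linear_inr (mul [::] [:: (0, v)])) linear_fst.
  by rewrite (graded_symmetric2 false false (0, u) (0, v) sym) /eps /= scaleN1r.
case: X => [|x [|y [|z X]]]; try exact: supp.
rewrite (multilinear_split [::] x [:: y] mul : F [:: x; y] = _) /=.
have splity a : F [:: hpart a x; y] = _ :=
  multilinear_split [:: hpart a x] y [::] mul.
rewrite !splity /=.
have e1 : F [:: hpart true x; hpart true y] = 0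
  := homogP (has_degree2 true true x y hdeg).
have e2 : F [:: hpart true x; hpart false y] = 0
  := homogP (has_degree2 true false x y hdeg).
have e3 : F [:: hpart false x; hpart true y] = 0
  := homogP (has_degree2 false true x y hdeg).
have e4 : (F [:: hpart false x; hpart false y]).2 = 0
  := homogP (has_degree2 false false x y hdeg).
by rewrite e1 e2 e3 !add0r; apply: injective_projections.
Qed.

(** E_{-1} would be sent to degree 0, where E vanishes. *)
Lemma degree1_form1 F : is_kform 1 1 F ->
  exists2 d : E2 -> E1, linear d &
    forall X, F X = if X is [:: x] then (0, d x.1) else 0.
Proof.
case=> -[mul sym hdeg] supp.
exists (fun a => (F [:: (a, 0)]).2) => [|X].
  exact: linear_comp (linear_comp linear_inl (mul [::] [::])) linear_snd.
case: X => [|x [|y X]]; try exact: supp.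
rewrite (multilinear_split [::] x [::] mul : F [:: x] = _) /=.
have e1 : F [:: hpart false x] = 0 := homogP (has_degree1 false x hdeg).
have e2 : (F [:: hpart true x]).1 = 0 := homogP (has_degree1 true x hdeg).
by rewrite e1 addr0; apply: injective_projections.
Qed.

(** Values have degree -3, -2 or -1: two arguments in E_{-2} give zero, a mixed pair gives f, and
    two in E_{-1} give g. *)
Lemma degree1_form2 F : is_kform 2 1 F ->
  exists (f : E2 -> E1 -> E2) (g : E1 -> E1 -> E1),
    [/\ forall v, linear (f^~ v), forall a, linear (f a), skew2 g &
    forall X, F X = if X is [:: x; y]
      then (f x.1 y.2 + f y.1 x.2, g x.2 y.2) else 0].
Proof.
case=> -[mul sym hdeg] supp.
exists (fun a v => (F [:: (a, 0); (0, v)]).1),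
  (fun u v => (F [:: (0, u); (0, v)]).2).
split=> [v|a||X].
- exact: linear_comp (linear_comp linear_inl (mul [::] [:: (0, v)])) linear_fst.
- exact: linear_comp (linear_comp linear_inr (mul [:: (a, 0)] [::])) linear_fst.
- split=> [v|u v].
    exact: linear_comp (linear_comp linear_inr (mul [::] [:: (0, v)])) linear_snd.
  by rewrite (graded_symmetric2 false false (0, u) (0, v) sym) /eps /= scaleN1r.
case: X => [|x [|y [|z X]]]; try exact: supp.
rewrite (multilinear_split [::] x [:: y] mul : F [:: x; y] = _) /=.
have splity a : F [:: hpart a x; y] = _ :=
  multilinear_split [:: hpart a x] y [::] mul.
rewrite !splity /=.
have e1 : F [:: hpart true x; hpart true y] = 0
  := homogP (has_degree2 true true x y hdeg).
have e2 : (F [:: hpart true x; hpart false y]).2 = 0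
  := homogP (has_degree2 true false x y hdeg).
have e3 : (F [:: hpart true y; hpart false x]).2 = 0
  := homogP (has_degree2 true false y x hdeg).
have e4 : (F [:: hpart false x; hpart false y]).1 = 0
  := homogP (has_degree2 false false x y hdeg).
rewrite e1 add0r (graded_symmetric2 true false y x sym) scale1r.
by apply: injective_projections; rewrite /= ?e2 ?e3 ?e4 ?addr0 ?add0r.
Qed.

(** Three arguments in E_{-1} give degree -2; any argument in E_{-2} pushes the value below the
    degrees of E. *)
Lemma degree1_form3 F : is_kform 3 1 F ->
  exists2 h : E1 -> E1 -> E1 -> E2, skew3 h &
    forall X, F X = if X is [:: x; y; z] then (h x.2 y.2 z.2, 0) else 0.
Proof.
case=> -[mul sym hdeg] supp.
exists (fun u v w => (F [:: (0, u); (0, v); (0, w)]).1) => [|X].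
  split=> [v w|u v w|u v w].
  - exact: linear_comp (linear_comp linear_inr (mul [::] [:: (0, v); (0, w)]))
      linear_fst.
  - by rewrite (graded_symmetric3 (0, u) (0, v) (0, w) sym).
  by rewrite (graded_symmetric3 (0, u) (0, v) (0, w) sym).
case: X => [|x [|y [|z [|t X]]]]; try exact: supp.
have e a b c : a || b || c -> F [:: hpart a x; hpart b y; hpart c z] = 0.
  have := homogP (has_degree3 a b c x y z hdeg).
  by case: a b c => -[] [].
rewrite (multilinear_split [::] x [:: y; z] mul : F [:: x; y; z] = _) /=.
have splity a : F [:: hpart a x; y; z] = _ :=
  multilinear_split [:: hpart a x] y [:: z] mul.
have splitz a b : F [:: hpart a x; hpart b y; z] = _ :=
  multilinear_split [:: hpart a x; hpart b y] z [::] mul.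
rewrite !splity /= !splitz /=.
rewrite !(e true) // !(e _ true) // (e _ _ true) // !add0r.
have e0 : (F [:: hpart false x; hpart false y; hpart false z]).2 = 0
  := homogP (has_degree3 false false false x y z hdeg).
by apply: injective_projections.
Qed.

Lemma euler0 (X : seq E) : size X != 1%N -> euler X = 0.
Proof. by case: X => [|? [|? ?]]. Qed.

Lemma euler_vform : is_vform 0 (@euler K E2 E1).
Proof.
split=> [s t|n d X s hX|n d X hX].
- case: s t => [|x s] [|y t] c u v; rewrite /euler /=; last 3 first.
  + by rewrite scaler0 addr0.
  + by case: s => [|? ?]; rewrite /= scaler0 addr0.
  + by case: s => [|? ?]; rewrite /= scaler0 addr0.
  rewrite !euler_mapE; apply: injective_projections => //=.
  by rewrite mulrnDl scalerMnr.
- have [e|n1] := eqVneq n 1%N; last by rewrite !euler0 ?size_tuple // scaler0.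
  subst n; have -> : s = 1%g by apply/permP => i; rewrite !ord1.
  have -> : permute 1%g X = X.
    by apply: eq_from_tnth => i; rewrite tnth_mktuple perm1.
  rewrite /koszul !(big_ord_recl, big_ord0) !(big_mkcond (fun _ => _ && _)).
  by rewrite !(big_ord_recl, big_ord0) /= !mulr1 scale1r.
have [e|n1] := eqVneq n 1%N; last first.
  by rewrite euler0 ?size_tuple // /homog /gcomp /= !if_same.
subst n; rewrite big_ord_recl big_ord0 !addr0.
case: X hX => -[|[a v] [|? ?]] //= ? /(_ ord0); rewrite (tnth_nth 0) /=.
rewrite /homog !euler_mapE /gcomp /= => -[<- <-].
by case: (d _ == -2); case: (d _ == -1); rewrite ?mul0rn.
Qed.

Lemma gcompD n x y : gcomp n (x + y) = gcomp n x + gcomp n y.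
Proof.
by rewrite /gcomp; case: (n == -2); case: (n == -1);
  apply: injective_projections; rewrite /= ?addr0.
Qed.

Lemma gcompZ n (c : K) x : gcomp n (c *: x) = c *: gcomp n x.
Proof.
by rewrite /gcomp; case: (n == -2); case: (n == -1);
  apply: injective_projections; rewrite /= ?scaler0.
Qed.

Lemma is_vformD D F G : is_vform D F -> is_vform D G -> is_vform D (F \+ G).
Proof.
move=> [mF sF dF] [mG sG dG]; split=> [s t|n d X s hX|n d X hX].
- exact: linear_add (mF s t) (mG s t).
- by rewrite /= (sF n d X s) // (sG n d X s) // scalerDr.
by rewrite /homog /= gcompD (dF n d X hX) (dG n d X hX).
Qed.

Lemma is_vformZ D F (c : K) : is_vform D F -> is_vform D (c \*: F).
Proof.
move=> [mF sF dF]; split=> [s t a u v|n d X s hX|n d X hX].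
- by rewrite /= mF scalerDr !scalerA mulrC.
- by rewrite /= (sF n d X s) // !scalerA mulrC.
by rewrite /homog /= gcompZ (dF n d X hX).
Qed.

Lemma nijenhuis_iff_cyclic_sum (l1 l2 l3 alpha : preform E2 E1) : 2 != 0 :> K ->
  is_kform 1 1 l1 -> is_kform 2 1 l2 -> is_kform 3 1 l3 -> is_kform 2 0 alpha ->
  nijenhuis (l1 \+ l2 \+ l3) (@euler _ E2 E1 \+ alpha)
    (@euler _ E2 E1 \+ 2 \*: alpha)
  <->
  (forall X Y Z : E,
     homog (-1) X -> homog (-1) Y -> homog (-1) Z ->
     alpha [:: l1 [:: alpha [:: X; Y]]; Z]
     + alpha [:: l1 [:: alpha [:: Y; Z]]; X]
     + alpha [:: l1 [:: alpha [:: Z; X]]; Y] = 0).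
Proof.
move=> nz2 h1 h2 h3 ha.
have [A skA aE] := degree0_form ha.
have [d d_lin l1E] := degree1_form1 h1.
have [f [g [fl fr skg l2E]]] := degree1_form2 h2.
have [h skh l3E] := degree1_form3 h3.
have D : quadruple d f g h by split.
have muE : l1 \+ l2 \+ l3 =1 quad_form d f g h.
  by case=> [|x [|y [|z [|t X]]]]; rewrite /= l1E l2E l3E ?addr0 ?add0r.
have NE : @euler K E2 E1 \+ alpha =1 euler_plus A.
  by case=> [|x [|y [|z X]]]; rewrite /= aE ?addr0 ?add0r.
have QE : @euler K E2 E1 \+ 2 \*: alpha =1 euler_plus (fun u v => A u v *+ 2).
  case=> [|x [|y [|z X]]]; rewrite /= aE ?scaler0 ?addr0 ?add0r //.
  by apply: injective_projections; rewrite /= ?scaler0 ?scaler_nat.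
have skA2 : skew2 (fun u v => A u v *+ 2).
  split=> [w c u v|u v]; first by rewrite skA.1 mulrnDl scalerMnr.
  by rewrite skA.2 mulNrn.
(* [N0] and [Q0] supply the two conditions in [nijenhuis] that S + alpha and S + 2 alpha are forms
   of degree 0. *)
have N0 := is_vformD euler_vform ha.1.
have Q0 := is_vformD euler_vform (is_vformZ 2 ha.1).
have brN := eq_rn_bracket 0 1 NE muE.
have dbl := double_bracketP skA D.
split=> [[_ _ e _] X Y Z _ _ _|hC].
  rewrite !aE !l1E ?aE /=.
  apply: injective_projections; rewrite /= ?addr0 //.
  have : forall u v w, (A (d (A u v)) w + A (d (A v w)) u + A (d (A w u)) v) *+ 2
      = 0.
    apply/dbl => W.
    by rewrite -(eq_rn_bracket 0 1 NE brN) e (eq_rn_bracket 0 1 QE muE).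
  move=> /(_ X.2 Y.2 Z.2)/eqP.
  (* Here the factor 2 is divided out. *)
  by rewrite -scaler_nat scaler_eq0 (negPf nz2) => /eqP.
split=> //.
  move=> W; rewrite (eq_rn_bracket 0 1 NE brN) (eq_rn_bracket 0 1 QE muE).
  (* Elements (0, u) are homogeneous of degree -1 by computation, so the hypothesis applies to them
     with [erefl]. *)
  apply: (dbl.2 _ W) => u v w; have := hC (0, u) (0, v) (0, w).
  by rewrite !aE !l1E ?aE /= => /(_ erefl erefl erefl)[->]; rewrite mul0rn.
by move=> W; rewrite (eq_rn_bracket 0 0 NE QE) bracket_euler_plus.
Qed.

End Coordinates.

Theorem theorem4p6 (R : realType) (b : base)
    (E2 E1 : lmodType (base_field R b))
    (l1 l2 l3 alpha : preform E2 E1)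
    (hmu : lie2_structure l1 l2 l3)
    (halpha : is_kform 2 0 alpha) :
  nijenhuis (l1 \+ l2 \+ l3) (@euler _ E2 E1 \+ alpha)
    (@euler _ E2 E1 \+ 2 \*: alpha)
  <->
  (forall X Y Z : gspace E2 E1,
     homog (-1) X -> homog (-1) Y -> homog (-1) Z ->
     alpha [:: l1 [:: alpha [:: X; Y]]; Z]
     + alpha [:: l1 [:: alpha [:: Y; Z]]; X]
     + alpha [:: l1 [:: alpha [:: Z; X]]; Y] = 0).
Proof.
have [h1 h2 h3 _] := hmu.
(* Both base fields are numeric fields, hence of characteristic zero, so 2 is nonzero. *)
by apply: nijenhuis_iff_cyclic_sum => //; rewrite pnatr_eq0.
Qed.
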